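(* Let $G$ be a Garside group of finite type with a fixed finite type Garside structure $(G,P,\Delta)$, and let $x\in G$. Then $$\mathrm{SC}(x)\subseteq\mathrm{RSSS}(x)\subseteq\mathrm{USS}(x)\subseteq\mathrm{SSS}(x)\subseteq\mathrm{SS}(x).$$ Moreover, if $\ell_s(x)>1$ then $\mathrm{SC}(x)=\mathrm{RSSS}(x)$; and if $\ell_s(x)=1$ then $$\mathrm{SC}(x)\subseteq\mathrm{RSSS}(x)=\mathrm{USS}(x)=\mathrm{SSS}(x),$$ where $\mathrm{SC}(x)$ is in general a proper subset of $\mathrm{RSSS}(x)$ (that is, there exist a Garside group of finite type with a finite type Garside structure and an element $x$ of it with $\ell_s(x)=1$ and $\mathrm{SC}(x)\subsetneq\mathrm{RSSS}(x)$).
   Context: Garside structure: a group $G$ with a submonoid $P$ (the positive elements), $P\cap P^{-1}=\{1\}$, and an element $\Delta\in P$ such that: (G1) the partial order $a\preccurlyeq b \Leftrightarrow a^{-1}b\in P$ on $G$ is a lattice order, with greatest common divisor $a\wedge b$ and least common multiple $a\vee b$; (G2) the set $[1,\Delta]=\{a\in G\mid 1\preccurlyeq a\preccurlyeq\Delta\}$ of simple elements generates $G$; (G3) $\Delta^{-1}P\Delta=P$; (G4) for every $x\in P\setminus\{1\}$, $\|x\|=\sup\{k\mid \exists a_1,\dots,a_k\in P\setminus\{1\},\ x=a_1\cdots a_k\}<\infty$. It is of finite type if $[1,\Delta]$ is finite. Notation: $x^{\alpha}=\alpha^{-1}x\alpha$; $x^G$ is the conjugacy class of $x$. $\inf(x)$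 is the maximal integer $p$ with $\Delta^p\preccurlyeq x$, $\sup(x)$ is the minimal integer $q$ with $x\preccurlyeq\Delta^q$, $\ell(x)=\sup(x)-\inf(x)$, and $\ell_s(x)=\min\{\ell(y)\mid y\in x^G\}$. Initial and final factors: $\iota(x)=x\Delta^{-\inf(x)}\wedge\Delta$ and $\varphi(x)=(\Delta^{\sup(x)-1}\wedge x)^{-1}x$. Cycling: $\mathbf c(x)=x^{\iota(x)}$; decycling: $\mathbf d(x)=x^{\varphi(x)^{-1}}$. (If $x=\Delta^p x_1\cdots x_r$ is the left normal form with $r>0$, then $\iota(x)=\Delta^p x_1\Delta^{-p}$ and $\varphi(x)=x_r$; if $\ell(x)=0$ then $\iota(x)=1$ and $\varphi(x)=\Delta$.) Preferred prefix: $\mathfrak p(x)=(x\Delta^{-\inf(x)})\wedge(x^{-1}\Delta^{\sup(x)})\wedge\Delta$. Cyclic sliding: $\mathfrak s(x)=\mathfrak p(x)^{-1}x\,\mathfrak p(x)$. Sets: $\mathrm{SS}(x)=\{y\in x^G\mid \inf(y)\text{ is maximal in }x^G\}$ (summit set); $\mathrm{SSS}(x)=\{y\in x^G\mid \ell(y)\text{ is minimal in }x^G\}=\{y\in x^G\mid \inf(y)\text{ is maximal and }\sup(y)\text{ is minimal in }x^G\}$ (super summit set); $\mathrm{USS}(x)=\{y\in\mathrm{SSS}(x)\mid \mathbf c^m(y)=y\text{ for some }m\ge1\}$ (ultra summit set); $\mathrm{RSSS}(x)=\{y\in x^G\mid \mathbf c^m(y)=y\text{ and }\mathbf d^n(y)=y\text{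 for some }m,n\ge1\}$ (reduced super summit set); $\mathrm{SC}(x)=\{y\in x^G\mid \mathfrak s^m(y)=y\text{ for some }m\ge1\}$ (set of sliding circuits). *)

(* Defs.v *)
From HB Require Import structures.
From mathcomp Require Import all_boot all_order all_algebra.
From mathcomp Require Import all_classical.

Set Implicit Arguments.
Unset Strict Implicit.
Unset Printing Implicit Defensive.

Import Order.TTheory GRing.Theory Num.Theory.

Local Open Scope classical_set_scope.
Local Open Scope group_scope.

Definition expgz (G : groupType) (x : G) (n : int) : G :=
  match n with
  | Posz m => x ^+ m
  | Negz m => x ^- m.+1
  end.

(* Default value 0 if A has no greatest (resp. least) element. *)
Definition maxz (A : set int) : int := xget (0 : int)%R (A `&` ubound A).
Definition minz (A : set int) : int := xget (0 : int)%R (A `&` lbound A).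

Section GarsideDefs.
Context {G : groupType}.

(* [x ^ a] is the library's conjugate a^-1 * (x * a). *)
Definition conj_class (x : G) : set G := [set x ^ a | a in [set: G]].

(* y lies on a cycle of f *)
Definition periodic (f : G -> G) (y : G) : Prop :=
  exists2 m : nat, (0 < m)%N & iter m f y = y.

Variables (P : set G) (D : G).

Definition gle (a b : G) : Prop := P (a^-1 * b).

Local Notation "a ≼ b" := (gle a b) (at level 70, no associativity).

Definition is_gcd (a b d : G) : Prop :=
  [/\ d ≼ a, d ≼ b & forall e, e ≼ a -> e ≼ b -> e ≼ d].

Definition is_lcm (a b m : G) : Prop :=
  [/\ a ≼ m, b ≼ m & forall e, a ≼ e -> b ≼ e -> m ≼ e].

Definition simples : set G := [set a | 1 ≼ a /\ a ≼ D].

Definition factor_lengths (x : G) : set nat :=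
  [set k | exists s : seq G, [/\ size s = k,
     forall a, a \in s -> P a /\ a <> 1 & x = \prod_(a <- s) a]].

(* No antisymmetry or transitivity of ≼ is required in the lattice condition:
   they follow from P being a submonoid with P ∩ P^-1 = {1}. In the last
   field, the norm of x, a supremum in N ∪ {oo}, is finite exactly when the
   set of lengths is bounded. *)
Record garside_structure : Prop := GarsideStructure {
  pos_monoid : monoid.umagma_closed [in P];
  pos_pointed : P `&` [set a^-1 | a in P] = [set 1];
  delta_pos : P D;
  has_gcd : forall a b, exists d, is_gcd a b d;
  has_lcm : forall a b, exists m, is_lcm a b m;
  simples_generate :
    smallest (fun H : set G => monoid.group_closed [in H]) simples = [set: G];
  pos_conj_delta : [set a ^ D | a in P] = P;
  finite_norm : forall x, P x -> x <> 1 -> has_ubound (factor_lengths x) }.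

Definition finite_type : Prop := finite_set simples.

(* Unique under [garside_structure]; 1 if a and b have no gcd. *)
Definition ggcd (a b : G) : G := xget 1 [set d | is_gcd a b d].

Definition ginf (x : G) : int := maxz [set p | expgz D p ≼ x].
Definition gsup (x : G) : int := minz [set q | x ≼ expgz D q].
Definition glen (x : G) : int := (gsup x - ginf x)%R.
Definition slen (x : G) : int := minz [set glen y | y in conj_class x].

Definition initial (x : G) : G := ggcd (x * expgz D (- ginf x)%R) D.
Definition final (x : G) : G := (ggcd (expgz D (gsup x - 1)%R) x)^-1 * x.
Definition cycling (x : G) : G := x ^ initial x.
Definition decycling (x : G) : G := x ^ (final x)^-1.

Definition preferred_prefix (x : G) : G :=
  ggcd (ggcd (x * expgz D (- ginf x)%R) (x^-1 * expgz D (gsup x))) D.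
Definition sliding (x : G) : G :=
  (preferred_prefix x)^-1 * x * preferred_prefix x.

Definition SS (x : G) : set G :=
  [set y | conj_class x y /\ forall z, conj_class x z -> (ginf z <= ginf y)%R].
Definition SSS (x : G) : set G :=
  [set y | conj_class x y /\ forall z, conj_class x z -> (glen y <= glen z)%R].
Definition USS (x : G) : set G := [set y | SSS x y /\ periodic cycling y].
Definition RSSS (x : G) : set G :=
  [set y | [/\ conj_class x y, periodic cycling y & periodic decycling y]].
Definition SC (x : G) : set G :=
  [set y | conj_class x y /\ periodic sliding y].

End GarsideDefs.

(* Main.v *)
Require Import Defs.
From HB Require Import structures.
From mathcomp Require Import all_boot all_order all_algebra.
From mathcomp Require Import all_classical.
From mathcomp Require Import zify.

(** Write [Δ] for [D], [≼] for left divisibility and [∧] for the gcd.  All the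
    operations considered conjugate [z], up to a power of [Δ], by a gcd of some
    of the elements [z Δ^-inf], [z^-1 Δ^sup] and [Δ].  Replacing [inf] and
    [sup] by fixed integers [p] and [q] gives level versions [c_p], [d_q] and
    [s_pq] of cycling, decycling and sliding, which agree with the original
    operations at every [z] with [inf z = p] and [sup z = q].

    Level operations are nonwidening: they keep any bound [Δ^r ≼ z] or
    [z ≼ Δ^r].  The reason is that the conjugators that do so are closed under
    gcd, and conjugation by [z Δ^n], [z^-1 Δ^n] or [Δ] amounts to conjugation
    by a power of [Δ].  Hence orbits stay in intervals [[Δ^p, Δ^q]], which are
    finite, and [inf] and [sup] are constant on closed orbits.

    Two facts carry the theorem.

    - If [q - p > 1] then [s_pq = c_p d_q = d_q c_p] ([lsliding_cd],
      [lsliding_dc]).  Sliding removes the common prefix [a] of the first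
      factor of [z] and the complement of the last one, and moves it to the
      end; this is the same as first moving the last factor [f] to the front
      and then cycling the resulting first factor [f a] (ignoring powers of
      [Δ]).  For commuting self-maps of a finite set, a point is periodic
      under the composite exactly when it is periodic under both, so when
      [ℓ(y) > 1] the element [y] is periodic under sliding if and only if it
      is periodic under cycling and decycling ([periodic_sliding_long]).  When [ℓ(y) ≤ 1],
      cycling and decycling of [y] are conjugations by powers of [Δ], so [y]
      is periodic under both ([periodic_short]).  This gives [SC ⊆ RSSS],
      equality when [ℓ_s > 1], and [SSS ⊆ RSSS] when [ℓ_s = 1].

    - If [inf] is not maximal on the conjugacy class of [x], some iterated
      cycling of [x] has larger infimum ([cycling_raises_inf]); so an element
      periodic under cycling has maximal infimum.  Decycling is, up to
      conjugation by [Δ], cycling of the inverse, and so an element periodic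
      under decycling has minimal supremum.  This gives [RSSS ⊆ USS], and
      cycling then decycling until periodicity shows that both extrema are
      attained simultaneously, whence [SSS ⊆ SS].

    For the strict inclusion, take [Z^3 ⋊ Z], where [1 ∈ Z] shifts the three
    coordinates cyclically, with the product order and [Δ = ((2,2,2),1)].  On
    the elements [(u,1)] with [0 ≤ u_i ≤ 2], sliding is a traffic rule: site
    [i] passes [min(u_i, 2 - u_(i+1))] units to site [i+1].  It sends the jam
    [(2,1,0)] to the free flow [(1,1,1)], which it fixes; so the jam, whose
    class has [ℓ_s = 1], is not on a sliding circuit. *)

Set Implicit Arguments.
Unset Strict Implicit.
Unset Printing Implicit Defensive.

Import Order.TTheory GRing.Theory Num.Theory.

Local Open Scope classical_set_scope.

(** * Periodic points of self-maps of finite sets *)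

Section Periodicity.

Lemma pigeonhole_seq (T : Type) (A : set T) (f : nat -> T) :
  finite_set A -> (forall i, A (f i)) ->
  exists i n, (0 < n)%N /\ f i = f (i + n)%N.
Proof.
move=> finA fA; apply: contrapT => norep.
have injf : injective f.
  move=> i j fij; case: (ltngtP i j) => // ltij; case: norep.
    by exists i, (j - i)%N; rewrite subn_gt0 subnKC // ltnW.
  by exists j, (i - j)%N; rewrite subn_gt0 subnKC // ltnW.
have : ([set: nat] #<= A)%card.
  rewrite (_ : [set: nat] = f @^-1` A); first by apply: card_ge_preimage => i j _ _ /injf.
  by apply/seteqP; split=> // i _; exact: fA.
by move/infiniteP; apply.
Qed.

Lemma iter_fixed (T : Type) (f : T -> T) x m k :
  iter m f x = x -> iter (k * m) f x = x.
Proof. by move=> fx; elim: k => // k IHk; rewrite mulSn iterD IHk. Qed.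

Lemma iter_stable (T : Type) (A : set T) (f : T -> T) x n :
  (forall y, A y -> A (f y)) -> A x -> A (iter n f x).
Proof. by move=> fA Ax; elim: n => //= n; exact: fA. Qed.

Lemma iter_comm (T : Type) (f g : T -> T) m n x :
  (forall y, f (g y) = g (f y)) -> iter m f (iter n g x) = iter n g (iter m f x).
Proof.
move=> fgC; have gfn y : iter n g (f y) = f (iter n g y).
  by elim: n => //= n ->; rewrite fgC.
by elim: m => //= m ->; rewrite gfn.
Qed.

Lemma iter_comp (T : Type) (f g : T -> T) n x :
  (forall y, f (g y) = g (f y)) ->
  iter n (fun y => f (g y)) x = iter n f (iter n g x).
Proof.
move=> fgC; elim: n => //= n ->.
by congr (f _); exact: (iter_comm (f := g) (g := f) 1 n).
Qed.

Lemma eventually_periodic (G : groupType) (A : set G) (f : G -> G) x :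
  finite_set A -> (forall n, A (iter n f x)) -> exists n, periodic f (iter n f x).
Proof.
move=> finA /(pigeonhole_seq finA) [i [n [n_gt0 fi]]].
by exists i, n; rewrite // -iterD addnC.
Qed.

Lemma periodic_inj (G : groupType) (A : set G) (f : G -> G) x :
  finite_set A -> injective f -> (forall n, A (iter n f x)) -> periodic f x.
Proof.
move=> finA injf /(pigeonhole_seq finA) [i [n [n_gt0]]].
rewrite iterD => fi; exists n => //.
by elim: i fi => //= i IHi /injf.
Qed.

(** If [(fg)^m] fixes [y] then [y = f^(mi) (g^(mi) y)] for all [i]; as soon as
    [g^(mi) y] repeats with period [mn], so does its image under [f^(mi)],
    that is, [f^(mn)] fixes [y]. *)
Lemma periodic_comp_left (G : groupType) (A : set G) (f g : G -> G) y :
  finite_set A -> (forall n, A (iter n g y)) -> (forall z, f (g z) = g (f z)) ->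
  periodic (fun z => f (g z)) y -> periodic f y.
Proof.
move=> finA gA fgC [m m_gt0 fgy].
have fgk k : iter (k * m) f (iter (k * m) g y) = y.
  by rewrite -iter_comp // iter_fixed.
have [i [n [n_gt0 gi]]] :=
  pigeonhole_seq (f := fun i => iter (i * m) g y) finA (fun i => gA _).
exists (n * m)%N; first by rewrite muln_gt0 n_gt0.
by rewrite -{1}(fgk i) gi -iterD -mulnDl addnC fgk.
Qed.

Lemma periodic_comp (G : groupType) (f g : G -> G) y :
  (forall z, f (g z) = g (f z)) -> periodic f y -> periodic g y ->
  periodic (fun z => f (g z)) y.
Proof.
move=> fgC [m m_gt0 fy] [n n_gt0 gy]; exists (m * n)%N.
  by rewrite muln_gt0 m_gt0.
by rewrite iter_comp // (iter_fixed m gy) mulnC (iter_fixed n fy).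
Qed.

Lemma eq_periodic (G : groupType) (f g : G -> G) y :
  (forall n, iter n f y = iter n g y) -> periodic f y -> periodic g y.
Proof. by move=> fg [m m0 fy]; exists m; rewrite // -fg. Qed.

End Periodicity.

(** * Extrema of sets of integers *)

Section IntExtrema.

Lemma maxzP (A : set int) a b :
  A a -> ubound A b -> A (maxz A) /\ ubound A (maxz A).
Proof.
move=> Aa Ab; rewrite /maxz; case: xgetP => [m -> [] //|none].
(* Without a greatest element, A reaches every a + k. *)
exfalso; have step k : exists2 c, A c & (a + k%:Z <= c)%R.
  elim: k => [|k [c Ac lec]]; first by exists a => //; rewrite ?addr0 ?subr0.
  apply: contrapT => nolarger; apply: (none c); split=> // d Ad.
  by rewrite leNgt; apply/negP => ltcd; apply: nolarger; exists d => //; lia.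
by have [c /Ab lecb] := step `|b - a|.+1; lia.
Qed.

Lemma minzP (A : set int) a b :
  A a -> lbound A b -> A (minz A) /\ lbound A (minz A).
Proof.
move=> Aa Ab; rewrite /minz; case: xgetP => [m -> [] //|none].
exfalso; have step k : exists2 c, A c & (c <= a - k%:Z)%R.
  elim: k => [|k [c Ac lec]]; first by exists a => //; rewrite ?addr0 ?subr0.
  apply: contrapT => nosmaller; apply: (none c); split=> // d Ad.
  by rewrite leNgt; apply/negP => ltdc; apply: nosmaller; exists d => //; lia.
by have [c /Ab lecb] := step `|b - a|.+1; lia.
Qed.

End IntExtrema.

Section Garside.

Local Arguments expgz : simpl never.

Context {G : groupType} {P : set G} {D : G}.
Hypothesis gs : garside_structure P D.

Local Open Scope group_scope.

Local Notation "a ≼ b" := (gle P a b) (at level 70, no associativity).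
Local Notation "a ⊓ b" := (ggcd P a b) (at level 48, left associativity).
Local Notation dp n := (expgz D n%R).

Implicit Types (a b c d e x y z : G) (m n p q : int).

(** Rewriting with these rules reduces a product to its free-group normal form. *)
Let group_simp :=
  (@mulgA G, @invgM G, @invgK G, @mulgK G, @mulgVK G, @mulVg G, @mulgV G,
   @mul1g G, @mulg1 G, @invg1 G).

(** * The divisibility lattice *)

Lemma pos1 : P 1.
Proof. by have [/set_mem] := pos_monoid gs. Qed.

Lemma posM a b : P a -> P b -> P (a * b).
Proof.
have [_ PM] := pos_monoid gs; move=> Pa Pb; apply/set_mem/PM; exact/mem_set.
Qed.

Lemma pos_anti a : P a -> P a^-1 -> a = 1.
Proof.
move=> Pa PVa; suff : [set 1] a by [].
by rewrite -(pos_pointed gs); split=> //; exists a^-1; rewrite ?invgK.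
Qed.

Lemma gle_refl a : a ≼ a.
Proof. by rewrite /gle mulVg; exact: pos1. Qed.

Lemma gle_trans b a c : a ≼ b -> b ≼ c -> a ≼ c.
Proof. by move=> ab bc; have := posM ab bc; rewrite !group_simp. Qed.

Lemma gle_anti a b : a ≼ b -> b ≼ a -> a = b.
Proof.
move=> ab ba; have /(congr1 (fun c => a * c)) : a^-1 * b = 1.
  by apply: pos_anti => //; rewrite !group_simp.
by rewrite mulVKg mulg1.
Qed.

Lemma gle_mul2l c a b : (c * a ≼ c * b) = (a ≼ b).
Proof. by rewrite /gle !group_simp. Qed.

Lemma gle1 a : (1 ≼ a) = P a.
Proof. by rewrite /gle invg1 mul1g. Qed.

Lemma gle_mulr a b : (a ≼ a * b) = P b.
Proof. by rewrite -[X in X ≼ _]mulg1 gle_mul2l gle1. Qed.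

Lemma dpD m n : dp (m + n) = dp m * dp n.
Proof.
have dpS k : dp (k + 1) = dp k * D.
  case: k => [k|[|k]].
  - by rewrite (_ : (Posz k + 1)%R = Posz k.+1) /expgz ?expgSr //; lia.
  - by rewrite /expgz /= mulVg.
  rewrite (_ : (Negz k.+1 + 1)%R = Negz k) /expgz; last by lia.
  by rewrite (expgS D k.+1) invgM mulgVK.
have dpP k : dp (k - 1) = dp k * D^-1.
  by apply: (@mulIg _ D); rewrite -dpS subrK mulgVK.
elim/int_rec: n => [|n IHn|n IHn]; first by rewrite addr0 mulg1.
  by rewrite -addn1 PoszD addrA !dpS IHn mulgA.
by rewrite -addn1 PoszD opprD addrA !dpP IHn mulgA.
Qed.

Lemma dp0 : dp 0 = 1. Proof. by []. Qed.
Lemma dp1 : dp 1 = D. Proof. by []. Qed.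

Lemma dpS (n : nat) : dp n.+1 = dp n * D.
Proof. by rewrite -addn1 PoszD dpD. Qed.

Lemma dpN n : dp (- n) = (dp n)^-1.
Proof. by apply: (@mulgI _ (dp n)); rewrite -dpD subrr mulgV. Qed.

Lemma pos_conj n a : P (a ^ dp n) = P a.
Proof.
have PD b : P (b ^ D) = P b.
  apply/propext; split=> [|Pb]; last by rewrite -(pos_conj_delta gs); exists b.
  by rewrite -[X in X (b ^ D)](pos_conj_delta gs) => -[c Pc /conjg_inj <-].
have PX k b : P (b ^ (D ^+ k)) = P b.
  by elim: k => [|k IHk]; rewrite ?conjg1 // expgSr conjgM PD.
by case: n => k; rewrite /expgz ?PX // -{2}(conjgKV (D ^+ k.+1) a) PX.
Qed.

(** Left divisibility is not invariant under right multiplication in general;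
    it is for powers of [Δ], since conjugation by [Δ] preserves [P]. *)
Lemma gle_mul2r n a b : (a * dp n ≼ b * dp n) = (a ≼ b).
Proof. by rewrite -[RHS](pos_conj n) conjgE /gle !group_simp. Qed.

Lemma gle_mulD a b : (a * D ≼ b * D) = (a ≼ b).
Proof. exact: (gle_mul2r 1). Qed.

Lemma gle_conj n a b : (a ^ dp n ≼ b ^ dp n) = (a ≼ b).
Proof. by rewrite !conjgE gle_mul2l gle_mul2r. Qed.

Lemma gle_inv_dp p z : (dp p ≼ z^-1) = (z ≼ dp (- p)).
Proof.
by rewrite -(gle_mul2l z) mulgV -(gle_mul2r (- p)) -mulgA -dpD subrr mulg1 mul1g.
Qed.

Lemma gle_dp_inv q z : (z^-1 ≼ dp q) = (dp (- q) ≼ z).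
Proof. by rewrite -[z in RHS]invgK gle_inv_dp opprK. Qed.

Lemma ggcdP a b : is_gcd P a b (a ⊓ b).
Proof.
rewrite /ggcd; case: xgetP => [d _|none] //.
by have [d /none] := has_gcd gs a b.
Qed.

Lemma lexI e a b : (e ≼ a ⊓ b) = (e ≼ a /\ e ≼ b).
Proof.
have [da db dmax] := ggcdP a b; apply/propext; split=> [ed|[]]; last exact: dmax.
by split; exact: gle_trans ed _.
Qed.

Lemma leIl a b : a ⊓ b ≼ a. Proof. by case: (ggcdP a b). Qed.
Lemma leIr a b : a ⊓ b ≼ b. Proof. by case: (ggcdP a b). Qed.

Lemma leI_trans a b e : a ≼ e \/ b ≼ e -> a ⊓ b ≼ e.
Proof. by case; apply: gle_trans; [exact: leIl | exact: leIr]. Qed.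

Lemma gcd_eq a b d : (forall e, (e ≼ d) = (e ≼ a /\ e ≼ b)) -> a ⊓ b = d.
Proof.
move=> dP; apply: gle_anti; first by rewrite dP -lexI; exact: gle_refl.
by rewrite lexI -dP; exact: gle_refl.
Qed.

Lemma gcd_unique a b d : is_gcd P a b d -> a ⊓ b = d.
Proof.
move=> [da db dmax]; apply: gcd_eq => e; apply/propext; split=> [ed|[]].
  by split; exact: gle_trans ed _.
exact: dmax.
Qed.

Lemma gcdC a b : a ⊓ b = b ⊓ a.
Proof. by apply: gcd_eq => e; rewrite lexI; apply/propext; tauto. Qed.

Lemma gcdA a b c : a ⊓ (b ⊓ c) = a ⊓ b ⊓ c.
Proof. by apply: gcd_eq => e; rewrite !lexI; apply/propext; tauto. Qed.

Lemma gcd_l a b : a ≼ b -> a ⊓ b = a.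
Proof.
move=> ab; apply: gcd_eq => e; apply/propext; split=> [ea|[]//].
by split=> //; exact: gle_trans ab.
Qed.

Lemma gcd_mull c a b : c * (a ⊓ b) = (c * a) ⊓ (c * b).
Proof.
apply/esym/gcd_eq => e.
by rewrite -(mulVKg c e) !gle_mul2l lexI.
Qed.

Lemma gcd_mulr n a b : (a ⊓ b) * dp n = (a * dp n) ⊓ (b * dp n).
Proof.
apply/esym/gcd_eq => e.
by rewrite -(mulgVK (dp n) e) !gle_mul2r lexI.
Qed.

Lemma gcd_conj n a b : (a ⊓ b) ^ dp n = (a ^ dp n) ⊓ (b ^ dp n).
Proof. by rewrite !conjgE gcd_mulr gcd_mull. Qed.

Lemma dp_pos n : (0 <= n)%R -> P (dp n).
Proof.
case: n => // n _; rewrite /expgz; elim: n => [|n IHn]; first exact: pos1.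
by rewrite expgSr; apply: posM => //; exact: (delta_pos gs).
Qed.

Lemma dp_le m n : (m <= n)%R -> dp m ≼ dp n.
Proof. by move=> mn; rewrite /gle -dpN -dpD; apply: dp_pos; lia. Qed.

(** * Cycling, decycling and sliding at prescribed levels *)

(** Fixing the levels [p] and [q], instead of recomputing [inf] and [sup] at
    every step, makes the identities between these operations hold for all
    elements, with no condition on their infimum and supremum. *)

Definition lcycling p z := z ^ ((z * dp (- p)) ⊓ D).
Definition ldecycling q z := z ^ ((dp (q - 1) ⊓ z)^-1 * z)^-1.
Definition lsliding p q z :=
  z ^ ((z * dp (- p)) ⊓ (z^-1 * dp q) ⊓ D).

Lemma cyclingE z : cycling P D z = lcycling (ginf P D z) z.
Proof. by []. Qed.

Lemma decyclingE z : decycling P D z = ldecycling (gsup P D z) z.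
Proof. by []. Qed.

Lemma slidingE z : sliding P D z = lsliding (ginf P D z) (gsup P D z) z.
Proof. by rewrite /lsliding conjgE mulgA. Qed.

(** The final factor [f] of [z] and the initial factor of [z^-1] are
    complementary: their product is [Δ]. *)
Lemma final_invE q z :
  ((dp (q - 1) ⊓ z)^-1 * z)^-1 = ((z^-1 * dp q) ⊓ D) * dp (- 1).
Proof.
by rewrite gcd_mulr -dp1 -mulgA -!dpD subrr invgM invgK gcd_mull mulVg.
Qed.

Lemma lcycling_conj p n z : lcycling p (z ^ dp n) = lcycling p z ^ dp n.
Proof.
rewrite /lcycling.
have -> : (z ^ dp n * dp (- p)) ⊓ D = ((z * dp (- p)) ⊓ D) ^ dp n.
  rewrite gcd_conj !conjgE -!dpN -dp1 -!mulgA -!dpD; congr ((_ * (_ * dp _)) ⊓ dp _); lia.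
by rewrite -conjJg.
Qed.

(** Decycling is cycling of the inverse, up to conjugation by [Δ]; this is how
    every statement on cycling is transferred to decycling. *)
Lemma ldecyclingE q z :
  ldecycling q z = (lcycling (- q) z^-1)^-1 ^ dp (- 1).
Proof.
by rewrite /ldecycling /lcycling final_invE opprK conjgM !conjVg invgK.
Qed.

Lemma lsliding_inv p q z : lsliding (- q) (- p) z^-1 = (lsliding p q z)^-1.
Proof.
by rewrite /lsliding opprK invgK [(z^-1 * _) ⊓ _]gcdC conjVg.
Qed.

(** Let [f] be the final factor of [z] and [u] its complement, [f u = Δ].
    Decycling gives [f z f^-1], whose initial factor is
    [f (Δ^(q-p-1) ∧ zΔ^-p ∧ u)].  As [u ≼ Δ ≼ Δ^(q-p-1)], this is [f] times the
    preferred prefix [zΔ^-p ∧ u], so that cycling cancels [f]. *)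
Lemma lsliding_cd p q z : (1 < q - p)%R ->
  lsliding p q z = lcycling p (ldecycling q z).
Proof.
move=> pq; set u := (z^-1 * dp q) ⊓ D; set f := (u * dp (- 1))^-1.
have fu : f * u = D by rewrite /f dpN invgM invgK mulgVK.
rewrite /ldecycling final_invE -/u.
have -> : u * dp (- 1) = f^-1 by rewrite invgK.
have zu : z * u = dp q ⊓ (z * D) by rewrite gcd_mull mulVKg.
rewrite /lcycling -conjgM; congr (_ ^ _).
have -> : z ^ f^-1 * dp (- p) = f * (dp (q - p - 1) ⊓ (z * dp (- p))).
  rewrite conjgE invgK -!mulgA; congr (f * _).
  rewrite {1}/f invgK !mulgA zu -mulgA -dpD gcd_mulr -mulgA -dp1 -!dpD.
  by congr (dp _ ⊓ (_ * dp _)); lia.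
rewrite -[X in f * _ ⊓ X]fu -gcd_mull mulgA mulVg mul1g.
have uD : u ≼ dp (q - p - 1).
  by apply: gle_trans (leIr _ _) _; rewrite -dp1; apply: dp_le; lia.
rewrite -!gcdA -/u [RHS]gcdC [RHS]gcd_l //.
exact: gle_trans (leIr _ _) uD.
Qed.

Lemma lsliding_dc p q z : (1 < q - p)%R ->
  lsliding p q z = ldecycling q (lcycling p z).
Proof.
move=> pq; apply: (@invg_inj G); rewrite -lsliding_inv lsliding_cd; last by lia.
by rewrite !ldecyclingE opprK !invgK lcycling_conj conjVg invgK.
Qed.

(** * Cycling and decycling never widen the interval of powers of [Δ] *)

Lemma dp_conj m n : dp m ^ dp n = dp m.
Proof. by rewrite conjgE -dpN -!dpD; congr (dp _); lia. Qed.

Lemma dp_le_conj n r z : (dp r ≼ z ^ dp n) = (dp r ≼ z).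
Proof. by rewrite -{1}(dp_conj r n) gle_conj. Qed.

Lemma le_dp_conj n r z : (z ^ dp n ≼ dp r) = (z ≼ dp r).
Proof. by rewrite -{1}(dp_conj r n) gle_conj. Qed.

(** The condition [Δ^r ≼ z ^ e] reads [e Δ^r ≼ z e], and both sides of this
    inequality turn gcds of [e] into gcds. *)
Lemma dp_le_conj_gcd r z a b :
  dp r ≼ z ^ a -> dp r ≼ z ^ b -> dp r ≼ z ^ (a ⊓ b).
Proof.
have conjE e : (dp r ≼ z ^ e) = (e * dp r ≼ z * e).
  by rewrite -[RHS](gle_mul2l e^-1) mulKg.
rewrite !conjE gcd_mulr gcd_mull => za zb; rewrite lexI.
by split; apply: leI_trans; [left|right].
Qed.

Lemma conj_gcd_le_dp r z a b :
  z ^ a ≼ dp r -> z ^ b ≼ dp r -> z ^ (a ⊓ b) ≼ dp r.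
Proof.
have conjE e : (z ^ e ≼ dp r) = (z * e ≼ e * dp r).
  by rewrite -[RHS](gle_mul2l e^-1) mulKg.
rewrite !conjE gcd_mulr gcd_mull => za zb; rewrite lexI.
by split; apply: leI_trans; [left|right].
Qed.

Definition nonwidening (f : G -> G) : Prop :=
  forall r z, (dp r ≼ z -> dp r ≼ f z) /\ (z ≼ dp r -> f z ≼ dp r).

Lemma nonwidening_conj n : nonwidening (fun z => z ^ dp n).
Proof. by move=> r z; rewrite dp_le_conj le_dp_conj. Qed.

Lemma nonwidening_iter f (n : nat) : nonwidening f -> nonwidening (iter n f).
Proof.
move=> fP r z; elim: n => //= n [IHlow IHup].
by split=> [/IHlow|/IHup]; [exact: (fP r _).1 | exact: (fP r _).2].
Qed.

Lemma nonwidening_comp f g :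
  nonwidening f -> nonwidening g -> nonwidening (fun z => f (g z)).
Proof.
move=> fP gP r z.
by split=> [/(gP r z).1|/(gP r z).2]; [exact: (fP r _).1 | exact: (fP r _).2].
Qed.

Lemma nonwidening_conj_gcd (a b : G -> G) :
  nonwidening (fun z => z ^ a z) -> nonwidening (fun z => z ^ b z) ->
  nonwidening (fun z => z ^ (a z ⊓ b z)).
Proof.
move=> aP bP r z; have [alow aup] := aP r z; have [blow bup] := bP r z.
split=> zr; first by apply: dp_le_conj_gcd; [exact: alow | exact: blow].
by apply: conj_gcd_le_dp; [exact: aup | exact: bup].
Qed.

(** Conjugating [z] by itself has no effect. *)
Lemma nonwidening_conj_self n : nonwidening (fun z => z ^ (z * dp n)).
Proof.
by move=> r z; rewrite conjgM [z ^ z]conjgE mulKg; exact: nonwidening_conj.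
Qed.

Lemma nonwidening_lcycling p : nonwidening (lcycling p).
Proof.
apply: nonwidening_conj_gcd; first exact: nonwidening_conj_self.
exact: (nonwidening_conj 1).
Qed.

Lemma nonwidening_conj_inv n : nonwidening (fun z => z ^ (z^-1 * dp n)).
Proof.
move=> r z; rewrite conjgM [z ^ z^-1]conjgE invgK mulgV mulg1.
exact: nonwidening_conj.
Qed.

Lemma nonwidening_ldecycling q : nonwidening (ldecycling q).
Proof.
move=> r z; rewrite /ldecycling final_invE conjgM dp_le_conj le_dp_conj.
apply: (nonwidening_conj_gcd (nonwidening_conj_inv q)).
exact: (nonwidening_conj 1).
Qed.

Lemma nonwidening_lsliding p q : nonwidening (lsliding p q).
Proof.
apply: nonwidening_conj_gcd; last exact: (nonwidening_conj 1).
apply: nonwidening_conj_gcd; first exact: nonwidening_conj_self.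
exact: nonwidening_conj_inv.
Qed.

(** * Finiteness of intervals *)

Hypothesis fin : finite_type P D.

Definition interval p q : set G := [set z | dp p ≼ z /\ z ≼ dp q].

(** Splitting off the gcd with [Δ] writes an element of [[1, Δ^(k+1)]] as a
    simple element times an element of [[1, Δ^k]]. *)
Lemma finite_pos_interval (k : nat) : finite_set (interval 0 k).
Proof.
elim: k => [|k IHk].
  apply: sub_finite_set (finite_set1 1) => a [a1 a1'] /=.
  exact/esym/(gle_anti a1 a1').
apply: sub_finite_set (finite_image2 (fun a b => a * b) fin IHk) => a [a_ge a_le].
have sP : P (a ⊓ D).
  by rewrite -gle1 lexI gle1 -gle1; split=> //; rewrite gle1; exact: (delta_pos gs).
exists (a ⊓ D); first by split; [rewrite gle1 | exact: leIr].
exists ((a ⊓ D)^-1 * a); last by rewrite mulVKg.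
split; first by rewrite gle1; exact: leIl.
rewrite -(gle_mul2l (a ⊓ D)) mulVKg gcd_mulr lexI; split.
  by rewrite gle_mulr; exact: dp_pos.
by rewrite -dp1 -dpD.
Qed.

Lemma finite_interval p q : finite_set (interval p q).
Proof.
have finI := finite_image (fun a => dp p * a) (finite_pos_interval `|q - p|).
apply: sub_finite_set finI => z [pz zq].
exists ((dp p)^-1 * z); last by rewrite mulVKg.
split; first by rewrite gle1.
rewrite -(gle_mul2l (dp p)) mulVKg -dpD.
by apply: gle_trans zq _; apply: dp_le; lia.
Qed.

(** The elements between two powers of [Δ] form a subgroup, and it contains the
    simple elements, which generate. *)
Lemma interval_exists z : exists p q, interval p q z.
Proof.
suff : smallest (fun H : set G => monoid.group_closed [in H]) (simples P D) `<=`
    [set z | exists p q, interval p q z].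
  by rewrite (simples_generate gs); apply.
apply: smallest_sub; last first.
  by move=> a [a_ge a_le]; exists 0%R, 1%R.
split; first by apply/mem_set; exists 0%R, 0%R; split; exact: gle_refl.
move=> a b /set_mem [p [q [pa aq]]] /set_mem [p' [q' [pb bq]]].
apply/mem_set; exists (p - q')%R, (q - p')%R; split.
  apply: gle_trans (_ : a * dp (- q') ≼ _); first by rewrite dpD gle_mul2r.
  by rewrite gle_mul2l gle_inv_dp opprK.
apply: gle_trans (_ : a * dp (- p') ≼ _); last by rewrite dpD gle_mul2r.
by rewrite gle_mul2l gle_dp_inv opprK.
Qed.

Lemma interval_iter f p q (n : nat) z :
  nonwidening f -> interval p q z -> interval p q (iter n f z).
Proof.
move=> /(nonwidening_iter n) fP [pz zq].
by split; [exact: (fP p z).1 | exact: (fP q z).2].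
Qed.

(** * Cycling reaches the maximal infimum *)

Definition linitial p z := (z * dp (- p)) ⊓ D.

Fixpoint cycling_conjugator p z (n : nat) : G :=
  if n is m.+1 then cycling_conjugator p z m * linitial p (iter m (lcycling p) z)
  else 1.

Local Notation W := cycling_conjugator.

Lemma cycling_conjugatorD p z (m n : nat) :
  W p z (m + n) = W p z m * W p (iter m (lcycling p) z) n.
Proof.
elim: n => [|n IHn]; first by rewrite addn0 mulg1.
by rewrite addnS /= IHn -mulgA -iterD addnC.
Qed.

Lemma cycling_conjugator_le p z (n : nat) : W p z n.+1 ≼ linitial p z * dp n.
Proof.
have W_le y (m : nat) : W p y m ≼ dp m.
  elim: m => [|m IHm] /=; first exact: gle_refl.
  apply: gle_trans (_ : W p y m * D ≼ _); first by rewrite gle_mul2l; exact: leIr.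
  by rewrite dpS gle_mulD.
by rewrite -add1n cycling_conjugatorD /= mul1g gle_mul2l.
Qed.

(** The element [ι^-1 a Δ] is the transport of [a] under cycling, the conjugator
    from the cycling of [x] to that of [x ^ a]: the latter has initial factor
    [Δ] at level [p], its infimum being larger than [p]. *)
Lemma transport_step p q x a :
  interval 0 q a -> dp (p + 1) ≼ x ^ a ->
  interval 0 q ((linitial p x)^-1 * a * D) /\
  dp (p + 1) ≼ lcycling p x ^ ((linitial p x)^-1 * a * D).
Proof.
rewrite -mulgA; move=> [a_ge a_le] xa; set i := linitial p x.
have aD : a * D ≼ x * a * dp (- p).
  move: xa; rewrite -(gle_mul2l a) mulVKg -(gle_mul2r (- p)) -mulgA -dpD.
  by rewrite (_ : (p + 1 - p)%R = 1%R) //; lia.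
split; last first.
  by rewrite /lcycling -conjgM mulVKg conjgM -dp1 dp_le_conj.
split.
  rewrite gle1; apply: gle_trans (leIr _ _) _.
  by rewrite -{1}[D]mul1g gle_mulD.
rewrite -(gle_mul2l i) mulVKg gcd_mulr lexI; split.
  apply: gle_trans aD _.
  by rewrite -!mulgA -dpD addrC dpD gle_mul2l gle_mul2r.
by rewrite -dp1 -dpD addrC dpD gle_mul2r.
Qed.

(** Let [a] in [[1, Δ^q]] conjugate [x] to an element of infimum above [p].
    Transporting [a] along the cyclings of [x] gives elements
    [b_n = W_n^-1 a Δ^n], with [W_n] the product of the first [n] initial
    factors, that all remain in the finite interval [[1, Δ^q]].  When both
    [b_i] and its conjugate by [Δ^i] recur after [n] more steps, [b_i] commutes
    with [Δ^n] and the product of the [n] initial factors in between is [Δ^n].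
    These factors being simple, the first of them is [Δ], which says that the
    infimum has increased. *)
Lemma cycling_raises_inf p x a :
  dp (p + 1) ≼ x ^ a -> exists n : nat, dp (p + 1) ≼ iter n (lcycling p) x.
Proof.
wlog [q aq] : a / exists q, interval 0 q a.
  move=> wl xa; have [r [s [ra as_]]] := interval_exists a.
  apply: (wl (a * dp (- r))); last by rewrite conjgM dp_le_conj.
  by exists (s - r)%R; split; rewrite -?(subrr r) dpD gle_mul2r.
move=> xa; pose b (n : nat) := (W p x n)^-1 * a * dp n.
have bP (n : nat) : interval 0 q (b n) /\ dp (p + 1) ≼ iter n (lcycling p) x ^ b n.
  elim: n => [|n [bq xb]]; first by rewrite /b invg1 mul1g mulg1.
  have -> : b n.+1 = (linitial p (iter n (lcycling p) x))^-1 * b n * D.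
    by rewrite /b dpS invgM !mulgA.
  exact: transport_step.
pose B := interval 0 q.
have BB (n : nat) : (B `*` B) (b n, b n ^ dp n).
  have [bq _] := bP n; split=> //=; split; rewrite /= ?le_dp_conj ?dp_le_conj; by case: bq.
have [i [[|n] [] // _ [bi ci]]] :=
  pigeonhole_seq (finite_setX (finite_interval 0 q) (finite_interval 0 q)) BB.
have bC : b i * dp n.+1 = dp n.+1 * b i.
  have : b i ^ dp n.+1 = b i.
    by apply: (@conjg_inj _ (dp i)); rewrite -conjgM -dpD addrC -PoszD ci -bi.
  by move=> {2}<-; rewrite mulVKg.
exists i; set y := iter i (lcycling p) x.
have Wdp : W p y n.+1 = dp n.+1.
  apply: (@mulIg _ (b i)); rewrite -bC {1}bi /b cycling_conjugatorD -/y.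
  by rewrite PoszD dpD invgM !mulgA mulgV mul1g.
have := cycling_conjugator_le p y n; rewrite Wdp -add1n PoszD dpD gle_mul2r.
rewrite lexI => -[yp _]; rewrite -(gle_mul2r (- p)) -dpD.
by rewrite (_ : (p + 1 - p)%R = 1%R) //; lia.
Qed.

Lemma decycling_lowers_sup q x a :
  x ^ a ≼ dp (q - 1) -> exists n : nat, iter n (ldecycling q) x ≼ dp (q - 1).
Proof.
move=> xa; have [n xn] : exists n : nat, dp (- q + 1) ≼ iter n (lcycling (- q)) x^-1.
  by apply: (cycling_raises_inf (a := a)); rewrite conjVg gle_inv_dp opprD opprK.
exists n; have -> : iter n (ldecycling q) x = (iter n (lcycling (- q)) x^-1)^-1 ^ dp (- n%:Z).
  elim: n {xn} => [|n /= ->]; first by rewrite invgK conjg1.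
  rewrite ldecyclingE -conjVg invgK lcycling_conj -!conjVg -conjgM -dpD.
  by congr (_ ^ dp _); lia.
by rewrite le_dp_conj gle_dp_inv opprB addrC.
Qed.

(** * Infimum, supremum and the invariant sets *)

(** If [D = 1] the group is trivial, and the sets of integers that define [inf]
    and [sup] have no extrema. *)
Hypothesis D_neq1 : D <> 1.

Lemma dp_le_inj m n : dp m ≼ dp n -> (m <= n)%R.
Proof.
move=> mn; rewrite leNgt; apply/negP => nm; apply: D_neq1.
have dpmn : dp m = dp n by apply: gle_anti => //; apply: dp_le; lia.
have D1 : D ≼ 1.
  rewrite -(gle_mul2r n) -{1}dp1 -dpD mul1g -dpmn; apply: dp_le; lia.
by apply: gle_anti => //; rewrite gle1; exact: (delta_pos gs).
Qed.

Lemma interval_inf_sup z : interval (ginf P D z) (gsup P D z) z.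
Proof.
have [p [q [pz zq]]] := interval_exists z.
have leq r : dp r ≼ z -> (r <= q)%R by move=> rz; apply: dp_le_inj; exact: gle_trans zq.
have gep r : z ≼ dp r -> (p <= r)%R by move=> zr; apply: dp_le_inj; exact: gle_trans zr.
split; first by have [] := @maxzP [set r | dp r ≼ z] p q pz leq.
by have [] := @minzP [set r | z ≼ dp r] q p zq gep.
Qed.

Lemma le_ginf p z : (dp p ≼ z) <-> (p <= ginf P D z)%R.
Proof.
have [low up] := interval_inf_sup z; split=> [pz|pz]; last exact: gle_trans (dp_le pz) low.
have ub r : dp r ≼ z -> (r <= gsup P D z)%R.
  by move=> rz; apply: dp_le_inj; exact: gle_trans up.
by have [_] := @maxzP [set r | dp r ≼ z] p _ pz ub; exact.
Qed.

Lemma gsup_le q z : (z ≼ dp q) <-> (gsup P D z <= q)%R.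
Proof.
have [low up] := interval_inf_sup z; split=> [zq|zq]; last exact: gle_trans up (dp_le zq).
have lb r : z ≼ dp r -> (ginf P D z <= r)%R.
  by move=> zr; apply: dp_le_inj; exact: gle_trans zr.
by have [_] := @minzP [set r | z ≼ dp r] q _ zq lb; exact.
Qed.

Lemma levels_of_interval p z : interval p (p + 1) z ->
  z <> dp p -> z <> dp (p + 1) -> ginf P D z = p /\ gsup P D z = (p + 1)%R.
Proof.
move=> [low up] zp zp1.
have inf_le : ~ (p + 1 <= ginf P D z)%R.
  by move=> /le_ginf pz; apply: zp1; exact: gle_anti.
have sup_ge : ~ (gsup P D z <= p)%R.
  by move=> /gsup_le zlep; apply: zp; exact: gle_anti.
by move: low up => /le_ginf low /gsup_le up; lia.
Qed.

Lemma glen_ge0 z : (0 <= glen P D z)%R.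
Proof.
by have [low up] := interval_inf_sup z; rewrite subr_ge0; apply: dp_le_inj; exact: gle_trans up.
Qed.

Lemma nonwidening_inf_sup f z : nonwidening f ->
  (ginf P D z <= ginf P D (f z) /\ gsup P D (f z) <= gsup P D z)%R.
Proof.
move=> fP; have [low up] := interval_inf_sup z; split.
  by apply/le_ginf; exact: (fP _ _).1.
by apply/gsup_le; exact: (fP _ _).2.
Qed.

Lemma nonwidening_cycling : nonwidening (cycling P D).
Proof. by move=> r z; rewrite cyclingE; exact: nonwidening_lcycling. Qed.

Lemma nonwidening_decycling : nonwidening (decycling P D).
Proof. by move=> r z; rewrite decyclingE; exact: nonwidening_ldecycling. Qed.

Lemma nonwidening_sliding : nonwidening (sliding P D).
Proof. by move=> r z; rewrite slidingE; exact: nonwidening_lsliding. Qed.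

Definition same_levels y z : Prop :=
  ginf P D z = ginf P D y /\ gsup P D z = gsup P D y.

(** The infimum cannot decrease and the supremum cannot increase along a
    closed orbit, so both are constant on it. *)
Lemma periodic_same_levels f y (n : nat) :
  nonwidening f -> periodic f y -> same_levels y (iter n f y).
Proof.
move=> fP [m m_gt0 fy].
have [inf1 sup1] := nonwidening_inf_sup y (nonwidening_iter n fP).
have [] := nonwidening_inf_sup (iter n f y) (nonwidening_iter (n * m - n) fP).
rewrite -iterD subnK; last by rewrite leq_pmulr.
by rewrite (iter_fixed n fy) => inf2 sup2; split; apply/eqP; rewrite eq_le ?inf1 ?inf2 ?sup1 ?sup2.
Qed.

(** The orbit of [y] stays at the levels of [y], so there [f] may be replaced by
    its fixed-level version, and conversely. *)
Lemma periodic_level f g y :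
  nonwidening f -> (forall z, same_levels y z -> f z = g z) ->
  periodic f y -> periodic g y.
Proof.
move=> fP fg fy; apply: eq_periodic (fy); elim=> //= n <-.
by apply: fg; exact: periodic_same_levels.
Qed.

Lemma cycling_level y z :
  same_levels y z -> cycling P D z = lcycling (ginf P D y) z.
Proof. by case=> <- _. Qed.

Lemma decycling_level y z :
  same_levels y z -> decycling P D z = ldecycling (gsup P D y) z.
Proof. by case=> _ <-. Qed.

Lemma periodic_cycling_level y :
  periodic (cycling P D) y <-> periodic (lcycling (ginf P D y)) y.
Proof.
split; first by apply: periodic_level nonwidening_cycling _ => z /cycling_level.
by apply: periodic_level (nonwidening_lcycling _) _ => z /cycling_level.
Qed.

Lemma periodic_decycling_level y :
  periodic (decycling P D) y <-> periodic (ldecycling (gsup P D y)) y.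
Proof.
split; first by apply: periodic_level nonwidening_decycling _ => z /decycling_level.
by apply: periodic_level (nonwidening_ldecycling _) _ => z /decycling_level.
Qed.

Lemma periodic_sliding_long y : (1 < glen P D y)%R ->
  periodic (sliding P D) y <->
  periodic (cycling P D) y /\ periodic (decycling P D) y.
Proof.
rewrite periodic_cycling_level periodic_decycling_level.
set p := ginf P D y; set q := gsup P D y => pq.
have cdC z : lcycling p (ldecycling q z) = ldecycling q (lcycling p z).
  by rewrite -lsliding_cd // lsliding_dc.
have slE : periodic (sliding P D) y <->
    periodic (fun z => lcycling p (ldecycling q z)) y.
  have slidE z : same_levels y z -> sliding P D z = lcycling p (ldecycling q z).
    by case=> zp zq; rewrite slidingE zp zq lsliding_cd.
  split; first exact: periodic_level nonwidening_sliding slidE.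
  apply: periodic_level => [|z /slidE //].
  exact: nonwidening_comp (nonwidening_lcycling p) (nonwidening_ldecycling q).
rewrite slE; have yE := interval_inf_sup y; split=> [cdy|[cy dy]]; last exact: periodic_comp.
split.
  apply: periodic_comp_left (finite_interval p q) _ cdC cdy => n.
  exact: interval_iter (nonwidening_ldecycling q) yE.
apply: (periodic_comp_left (finite_interval p q) (g := lcycling p)) => [n|//|].
  exact: interval_iter (nonwidening_lcycling p) yE.
by apply: eq_periodic cdy; elim=> //= n ->; rewrite cdC.
Qed.

Lemma periodic_conj_dp n y : periodic (fun z => z ^ dp n) y.
Proof.
have [p [q yE]] := interval_exists y.
apply: (periodic_inj (finite_interval p q)) => [z z' /conjg_inj //|m].
exact: interval_iter (nonwidening_conj n) yE.
Qed.

(** If [Δ^p ≼ z ≼ Δ^(p+1)] then [z] is a simple element up to [Δ^p], and it is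
    cycled or decycled as a whole: both operations are conjugations by powers
    of [Δ]. *)
Lemma periodic_short y : (glen P D y <= 1)%R ->
  periodic (cycling P D) y /\ periodic (decycling P D) y.
Proof.
move=> short; split.
  apply: periodic_level (nonwidening_conj _) _ (periodic_conj_dp (- ginf P D y) y).
  move=> z yz; rewrite (cycling_level yz) /lcycling gcd_l.
    by rewrite conjgM [z ^ z]conjgE mulKg.
  case: yz => zp zq; rewrite -(gle_mul2r (ginf P D y)) -mulgA -dpD addNr dp0 mulg1.
  rewrite (_ : D * _ = dp (1 + ginf P D y)); last by rewrite dpD.
  by apply/gsup_le; rewrite zq; rewrite /glen in short; lia.
apply: periodic_level (nonwidening_conj _) _ (periodic_conj_dp (gsup P D y - 1) y).
move=> z yz; rewrite (decycling_level yz) /ldecycling gcd_l.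
  by rewrite invgM invgK conjgM [z ^ z^-1]conjgE invgK mulgV mulg1.
by case: yz => zp zq; apply/le_ginf; rewrite zp; rewrite /glen in short; lia.
Qed.

Lemma cycling_periodic_inf_max y a :
  periodic (cycling P D) y -> (ginf P D (y ^ a) <= ginf P D y)%R.
Proof.
rewrite periodic_cycling_level => cy; rewrite leNgt; apply/negP => lt_inf.
have [|n /le_ginf] := cycling_raises_inf (p := ginf P D y) (x := y) (a := a).
  by rewrite le_ginf; lia.
have [-> _] := periodic_same_levels n (nonwidening_lcycling _) cy; lia.
Qed.

Lemma decycling_periodic_sup_min y a :
  periodic (decycling P D) y -> (gsup P D y <= gsup P D (y ^ a))%R.
Proof.
rewrite periodic_decycling_level => dy; rewrite leNgt; apply/negP => lt_sup.
have [|n /gsup_le] := decycling_lowers_sup (q := gsup P D y) (x := y) (a := a).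
  by rewrite gsup_le; lia.
have [_ ->] := periodic_same_levels n (nonwidening_ldecycling _) dy; lia.
Qed.

Lemma conj_class_refl x : conj_class x x.
Proof. by exists 1; rewrite ?conjg1. Qed.

Lemma conj_class_conj x y a : conj_class x y -> conj_class x (y ^ a).
Proof. by case=> b _ <-; exists (b * a); rewrite ?conjgM. Qed.

Lemma conj_class_rel x y z : conj_class x y -> conj_class x z -> exists a, z = y ^ a.
Proof. by case=> b _ <- [c _ <-]; exists (b^-1 * c); rewrite conjgM conjgK. Qed.

(** Cycling until periodicity maximizes the infimum; decycling from there until
    periodicity minimizes the supremum, and cannot lower the infimum again. *)
Lemma exists_cycling_decycling_periodic x :
  exists y, [/\ conj_class x y,
                forall z, conj_class x z -> (ginf P D z <= ginf P D y)%R
              & periodic (decycling P D) y].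
Proof.
have stay f (n : nat) z : nonwidening f -> interval (ginf P D z) (gsup P D z) (iter n f z).
  by move=> fP; apply: interval_iter fP (interval_inf_sup z).
have [m cm] := eventually_periodic (finite_interval _ _)
  (fun n : nat => stay _ n x nonwidening_cycling).
set y := iter m _ x in cm.
have [n dn] := eventually_periodic (finite_interval _ _)
  (fun n : nat => stay _ n y nonwidening_decycling).
have xy : conj_class x y.
  by apply: iter_stable (conj_class_refl x) => z; exact: conj_class_conj.
exists (iter n (decycling P D) y); split=> //.
  by apply: iter_stable xy => z; exact: conj_class_conj.
move=> z xz; have [a ->] := conj_class_rel xy xz.
apply: le_trans (cycling_periodic_inf_max a cm) _.
exact: (nonwidening_inf_sup y (nonwidening_iter n nonwidening_decycling)).1.
Qed.

Lemma slenP x :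
  (exists2 y, conj_class x y & glen P D y = slen P D x) /\
  (forall z, conj_class x z -> (slen P D x <= glen P D z)%R).
Proof.
have [] := @minzP [set glen P D y | y in conj_class x] (glen P D x) 0%R.
- by exists x => //; exact: conj_class_refl.
- by move=> _ [y _ <-]; exact: glen_ge0.
by move=> [y xy yl] lb; split=> [|z xz]; [exists y | apply: lb; exists z].
Qed.

Lemma SC_sub_RSSS x : SC P D x `<=` RSSS P D x.
Proof.
move=> y [xy sy]; have [short|long] := leP (glen P D y) 1%R.
  by have [] := periodic_short short; split.
by have [] := (periodic_sliding_long long).1 sy; split.
Qed.

Lemma RSSS_sub_USS x : RSSS P D x `<=` USS P D x.
Proof.
move=> y [xy cy dy]; split=> //; split=> // z xz.
have [a ->] := conj_class_rel xy xz.
rewrite /glen; apply: lerB; first exact: decycling_periodic_sup_min.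
exact: cycling_periodic_inf_max.
Qed.

(** Once some [w] in the class has both maximal infimum and minimal supremum,
    minimality of the length of [y] forces [inf y = inf w]. *)
Lemma SSS_sub_SS x : SSS P D x `<=` SS P D x.
Proof.
move=> y [xy miny]; split=> // z xz.
have [w [xw maxw dw]] := exists_cycling_decycling_periodic x.
have [a ya] := conj_class_rel xw xy.
have := decycling_periodic_sup_min a dw; rewrite -ya.
have := maxw z xz; have := miny w xw; rewrite /glen; lia.
Qed.

Lemma SC_eq_RSSS x : (1 < slen P D x)%R -> SC P D x = RSSS P D x.
Proof.
move=> long; apply/seteqP; split; first exact: SC_sub_RSSS.
move=> y [xy cy dy]; split=> //; apply/periodic_sliding_long => //.
exact: lt_le_trans long ((slenP x).2 y xy).
Qed.

Lemma SSS_sub_RSSS x : slen P D x = 1%R -> SSS P D x `<=` RSSS P D x.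
Proof.
move=> sl1 y [xy miny]; have [[z xz zl] _] := slenP x.
have [|cy dy] := @periodic_short y; first by rewrite -sl1 -zl; exact: miny.
by split.
Qed.

End Garside.

(** * A Garside structure on the semidirect product of Z^3 by Z *)

Section CyclicShift.

Local Open Scope ring_scope.

Definition shift (k : int) (f : {ffun 'Z_3 -> int}) : {ffun 'Z_3 -> int} :=
  [ffun i => f (i - k%:~R)].

Lemma shift0 f : shift 0 f = f.
Proof. by apply/ffunP => i; rewrite ffunE subr0. Qed.

Lemma shiftD k l f : shift (k + l) f = shift k (shift l f).
Proof. by apply/ffunP => i; rewrite !ffunE intrD opprD addrA. Qed.

Lemma shift_is_add k : {morph shift k : f g / f + g}.
Proof. by move=> f g; apply/ffunP => i; rewrite !ffunE. Qed.

Lemma shiftN k f : shift k (- f) = - shift k f.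
Proof. by apply/ffunP => i; rewrite !ffunE. Qed.

Lemma sum_shift k f : \sum_i shift k f i = \sum_i f i.
Proof.
rewrite [RHS](reindex_inj (addIr (- k%:~R))) /=.
by apply: eq_bigr => i _; rewrite ffunE.
Qed.

End CyclicShift.

(** The pair [(u, k)] stands for [u t^k], where [t u t^-1] is the shift of [u]. *)
Definition shift_group : Type := ({ffun 'Z_3 -> int} * int)%type.
HB.instance Definition _ := Choice.on shift_group.

Definition sg_one : shift_group := (0, 0)%R.
Definition sg_mul (a b : shift_group) : shift_group :=
  (a.1 + shift a.2 b.1, a.2 + b.2)%R.
Definition sg_inv (a : shift_group) : shift_group :=
  (- shift (- a.2) a.1, - a.2)%R.

Fact sg_mulA : associative sg_mul.
Proof. by move=> a b c; rewrite /sg_mul /= shift_is_add shiftD !addrA. Qed.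

Fact sg_mul1 : left_id sg_one sg_mul.
Proof. by case=> f k; rewrite /sg_mul /= shift0 !add0r. Qed.

Fact sg_1mul : right_id sg_one sg_mul.
Proof.
case=> f k; rewrite /sg_mul /= !addr0; congr pair.
by apply/ffunP => i; rewrite !ffunE addr0.
Qed.

Fact sg_mulV : left_inverse sg_one sg_inv sg_mul.
Proof. by case=> f k; rewrite /sg_mul /= !addNr. Qed.

Fact sg_Vmul : right_inverse sg_one sg_inv sg_mul.
Proof. by case=> f k; rewrite /sg_mul /= shiftN -shiftD !subrr shift0 subrr. Qed.

HB.instance Definition _ :=
  isGroup.Build shift_group sg_mulA sg_mul1 sg_1mul sg_mulV sg_Vmul.

Section ShiftGroup.

Local Open Scope group_scope.

Implicit Types (a b c : shift_group) (f g : {ffun 'Z_3 -> int}) (k : int).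

Lemma sgM a b : a * b = (a.1 + shift a.2 b.1, a.2 + b.2)%R :> shift_group.
Proof. by []. Qed.

Lemma sgV a : a^-1 = (- shift (- a.2) a.1, - a.2)%R :> shift_group.
Proof. by []. Qed.

Definition sg_pos : set shift_group :=
  [set a : shift_group | (forall i, 0 <= a.1 i)%R /\ (0 <= a.2)%R].

Definition sg_delta : shift_group := ([ffun=> 2%R], 1%R).

(** The shift permutes coordinates and so preserves nonnegativity: divisibility
    is the product order of [Z^3 × Z], a lattice order. *)
Lemma sg_gleP a b :
  gle sg_pos a b <-> (forall i, a.1 i <= b.1 i)%R /\ (a.2 <= b.2)%R.
Proof.
rewrite /gle sgM sgV /sg_pos /= [(- _ + b.2)%R]addrC subr_ge0.
split=> -[le12 ->]; split=> // i.
  have := le12 (i - a.2%:~R)%R; rewrite !ffunE /= mulrNz opprK subrK addrC.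
  by rewrite subr_ge0.
by rewrite !ffunE /= addrC subr_ge0.
Qed.

Definition sg_meet a b : shift_group :=
  ([ffun i => Num.min (a.1 i) (b.1 i)], Num.min a.2 b.2).
Definition sg_join a b : shift_group :=
  ([ffun i => Num.max (a.1 i) (b.1 i)], Num.max a.2 b.2).

Lemma sg_meetP a b : is_gcd sg_pos a b (sg_meet a b).
Proof.
split=> [||c /sg_gleP [ca ca2] /sg_gleP [cb cb2]]; apply/sg_gleP; rewrite /=.
- by split=> [i|]; rewrite ?ffunE ge_min lexx.
- by split=> [i|]; rewrite ?ffunE ge_min lexx orbT.
- by split=> [i|]; rewrite ?ffunE le_min ?ca ?cb ?ca2.
Qed.

Lemma sg_joinP a b : is_lcm sg_pos a b (sg_join a b).
Proof.
split=> [||c /sg_gleP [ca ca2] /sg_gleP [cb cb2]]; apply/sg_gleP; rewrite /=.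
- by split=> [i|]; rewrite ?ffunE le_max lexx.
- by split=> [i|]; rewrite ?ffunE le_max lexx orbT.
- by split=> [i|]; rewrite ?ffunE ge_max ?ca ?cb ?ca2.
Qed.

(** A group morphism to [Z] that is positive on [P \ {1}]: it bounds the number of
    factors of a positive element, and it is constant on conjugacy classes. *)
Definition degree a : int := (\sum_i a.1 i + a.2)%R.

Lemma degreeM a b : degree (a * b) = (degree a + degree b)%R.
Proof.
rewrite /degree sgM /= addrACA; congr (_ + _)%R.
by rewrite -(sum_shift a.2 b.1) -big_split; apply: eq_bigr => i _; rewrite ffunE.
Qed.

Lemma degree1 : degree 1 = 0%R.
Proof. by rewrite /degree /= big1 // => i _; rewrite ffunE. Qed.

Lemma degreeV a : degree a^-1 = (- degree a)%R.
Proof. by apply/eqP; rewrite -addr_eq0 -degreeM mulVg degree1. Qed.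

Lemma degreeJ a b : degree (a ^ b) = degree a.
Proof. by rewrite conjgE !degreeM degreeV addrCA addNr addr0. Qed.

Lemma degree_gt0 a : sg_pos a -> a <> 1 -> (1 <= degree a)%R.
Proof.
case: a => f k [/= f_ge0 k_ge0] a_neq1; rewrite leNgt; apply/negP => deg_lt1.
have sum_ge0 : (0 <= \sum_i f i)%R by apply: sumr_ge0 => i _; exact: f_ge0.
have [sum0 k0] : (\sum_i f i = 0 /\ k = 0)%R.
  by move: deg_lt1 sum_ge0; rewrite /degree /=; set S := bigop _ _ _; split; lia.
apply: a_neq1; rewrite k0; congr pair; apply/ffunP => i; rewrite [RHS]ffunE.
by move/eqP: sum0; rewrite psumr_eq0 // => /allP /(_ i (mem_index_enum _)) /eqP.
Qed.

Lemma sg_pos_conj_delta a : sg_pos (a ^ sg_delta) <-> sg_pos a.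
Proof.
have -> : a ^ sg_delta = (shift (-1) a.1, a.2).
  rewrite conjgE !sgM sgV /=; congr pair; last by rewrite addrCA addNr addr0.
  by apply/ffunP => i; rewrite !ffunE addrCA addNr addr0.
split=> -[/= f0 k0]; split=> //= i; last by rewrite ffunE.
by have := f0 (i + (-1)%:~R)%R; rewrite ffunE addrK.
Qed.

Lemma int_generated (Q : int -> Prop) :
  Q 1%R -> (forall m n, Q m -> Q n -> Q (m - n)%R) -> forall n, Q n.
Proof.
move=> Q1 QB; have Q0 : Q 0%R by rewrite -(subrr (1 : int)%R); exact: QB.
have QN n : Q n -> Q (- n)%R by rewrite -sub0r; exact: QB.
have Qn (n : nat) : Q n.
  elim: n => // n Qn; rewrite (_ : Posz n.+1 = (n%:Z - - 1)%R); last by lia.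
  exact/QB/QN.
by case=> [//|n]; rewrite NegzE; exact/QN.
Qed.

Lemma sg_simplesP a :
  simples sg_pos sg_delta a <->
  (forall i, 0 <= a.1 i <= 2)%R /\ (0 <= a.2 <= 1)%R.
Proof.
rewrite /simples /= !sg_gleP /=; split=> [[[f0 k0] [f2 k1]]|[f02 /andP [-> ->]]].
  rewrite k0 k1; split=> // i; have := f0 i; have := f2 i.
  by rewrite !ffunE => -> ->.
by split; split=> // i; rewrite ffunE; case/andP: (f02 i).
Qed.

Lemma sg_simples_generate :
  smallest (fun H : set shift_group => monoid.group_closed [in H])
    (simples sg_pos sg_delta) = [set: shift_group].
Proof.
apply/seteqP; split=> // -[f k] _ H [[/set_mem H1 HB] simH].
have {HB}HV a b : H a -> H b -> H (a * b^-1).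
  by move=> /mem_set Ha /mem_set Hb; exact/set_mem/HB.
have HM a b : H a -> H b -> H (a * b).
  by move=> Ha Hb; rewrite -[b]invgK; apply: (HV) => //; rewrite -[b^-1]mul1g; exact: HV.
have Hk n : H (0%R, n).
  apply: (int_generated (Q := fun n => H (0%R, n))) => {n} [|m n Hm Hn].
    by apply: simH; apply/sg_simplesP; split=> //= i; rewrite ffunE.
  have := HV _ _ Hm Hn; rewrite sgM sgV /=; congr (H (_, _)).
  by apply/ffunP => i; rewrite !ffunE.
pose e i n : {ffun 'Z_3 -> int} := [ffun j => if j == i then n else 0%R].
have He i n : H (e i n, 0%R).
  apply: (int_generated (Q := fun n => H (e i n, 0%R))) => {n} [|m n Hm Hn].
    apply: simH; apply/sg_simplesP; split=> //= j; rewrite ffunE.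
    by case: (j == i).
  have := HV _ _ Hm Hn; rewrite sgM sgV /= oppr0 !shift0 subr0; congr (H (_, _)).
  by apply/ffunP => j; rewrite !ffunE; case: (j == i); rewrite // subr0.
have Hf : H (f, 0%R).
  have -> : f = (\sum_i e i (f i))%R.
    apply/ffunP => j; rewrite sum_ffunE (bigD1 j) //= ffunE eqxx big1 ?addr0 // => i ij.
    by rewrite ffunE eq_sym (negbTE ij).
  apply: (big_ind (fun g => H (g, 0%R))) => // g g' Hg Hg'.
  by have := HM _ _ Hg Hg'; rewrite sgM /= shift0.
have := HM _ _ Hf (Hk k); rewrite sgM /= add0r; congr (H (_, _)).
by apply/ffunP => i; rewrite !ffunE addr0.
Qed.

Lemma sg_finite_type : finite_type sg_pos sg_delta.
Proof.
pose F (u : {ffun 'Z_3 -> 'I_3} * bool) : shift_group :=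
  ([ffun i => Posz (u.1 i)], Posz u.2).
apply: sub_finite_set (finite_image F (@finite_finset _ setT)) => -[f k] /sg_simplesP /= [f02 k01].
exists ([ffun i => inord `|f i|], `|k|%N == 1%N) => //; rewrite /F /=; congr pair; last first.
  by case: k k01 => [[|[|k]]|k].
apply/ffunP => i; rewrite !ffunE.
by case: (f i) (f02 i) => [[|[|[|m]]]|m] //= _; rewrite inordK.
Qed.

Lemma sg_garside : garside_structure sg_pos sg_delta.
Proof.
split.
- split; first by apply/mem_set; split=> // i; rewrite ffunE.
  move=> a b /set_mem [a1 a2] /set_mem [b1 b2]; apply/mem_set.
  by split=> [i|]; rewrite sgM /= ?ffunE addr_ge0 // ffunE.
- apply/seteqP; split=> [x [px [a pb xE]]|_ ->] /=.
    rewrite -xE in px *; move: px => pa.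
    apply: contrapT => V1; have := degree_gt0 pa V1.
    have a1 : a <> 1 by move=> a1; apply: V1; rewrite a1 invg1.
    by have := degree_gt0 pb a1; rewrite degreeV; lia.
  have p1 : sg_pos 1 by split=> // i; rewrite ffunE.
  by split=> //; exists 1; rewrite ?invg1.
- by split=> // i; rewrite ffunE.
- by move=> a b; exists (sg_meet a b); exact: sg_meetP.
- by move=> a b; exists (sg_join a b); exact: sg_joinP.
- exact: sg_simples_generate.
- apply/seteqP; split=> [_ [a pa <-]|a pa]; first exact/sg_pos_conj_delta.
  exists (a ^ sg_delta^-1); last by rewrite -conjgM mulVg conjg1.
  by apply/sg_pos_conj_delta; rewrite -conjgM mulVg conjg1.
- move=> x px x1; exists `|degree x|%N => _ [s [<- sP ->]].
  suff : (Posz (size s) <= degree (\prod_(a <- s) a)%g)%R by lia.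
  elim: s sP => [|a s IHs] sP; first by rewrite big_nil degree1.
  rewrite big_cons degreeM; have [pa a1] := sP a (mem_head _ _).
  have := degree_gt0 pa a1; have := IHs (fun b sb => sP b (mem_behead (s := a :: s) sb)).
  by rewrite /=; lia.
Qed.

(** * An element of the reduced super summit set outside all sliding circuits *)

Lemma sg_ggcdE a b : ggcd sg_pos a b = sg_meet a b.
Proof. exact: (gcd_unique sg_garside (sg_meetP a b)). Qed.

Lemma sg_delta_neq1 : sg_delta <> 1.
Proof. by case. Qed.

(** The units on the sites [0, 1, 2] of a ring, each site holding at most two:
    [jam] is [(2, 1, 0)] and [flow] is [(1, 1, 1)]. *)
Definition jam : shift_group := ([ffun i : 'Z_3 => Posz (2 - i)], 1%R).
Definition flow : shift_group := ([ffun=> 1%R], 1%R).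

Lemma sg_levels a : (forall i, 0 <= a.1 i <= 2)%R -> a.2 = 1%R -> (a.1 1%R < 2)%R ->
  ginf sg_pos sg_delta a = 0%R /\ gsup sg_pos sg_delta a = 1%R.
Proof.
move=> a02 a2 a1.
have [a_ge a_le] : simples sg_pos sg_delta a by apply/sg_simplesP; rewrite a2.
apply: (levels_of_interval sg_garside sg_delta_neq1 (p := 0%R)) => // aE.
  by move: a2; rewrite aE.
by move: a1; rewrite aE ffunE.
Qed.

Lemma jam_levels : ginf sg_pos sg_delta jam = 0%R /\ gsup sg_pos sg_delta jam = 1%R.
Proof. by apply: sg_levels => [i||]; rewrite /= ?ffunE //; lia. Qed.

Lemma flow_levels : ginf sg_pos sg_delta flow = 0%R /\ gsup sg_pos sg_delta flow = 1%R.
Proof. by apply: sg_levels => [i||]; rewrite /= ?ffunE. Qed.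

(** The preferred prefix of [jam] is [((1, 1, 0), 0)]: one unit leaves each of
    the sites [0] and [1]. *)
Lemma sliding_jam : sliding sg_pos sg_delta jam = flow.
Proof.
rewrite slidingE; have [-> ->] := jam_levels; rewrite /lsliding !sg_ggcdE.
rewrite conjgE !sgM !sgV /=; congr pair; apply/ffunP => i; rewrite !ffunE.
by case: i => -[|[|[|//]]] ?.
Qed.

Lemma sliding_flow : sliding sg_pos sg_delta flow = flow.
Proof.
rewrite slidingE; have [-> ->] := flow_levels; rewrite /lsliding !sg_ggcdE.
by rewrite conjgE !sgM !sgV /=; congr pair; apply/ffunP => i; rewrite !ffunE.
Qed.

Lemma jam_not_SC : ~ SC sg_pos sg_delta jam jam.
Proof.
move=> [_ [[//|m] _]]; rewrite iterSr sliding_jam.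
have -> : iter m (sliding sg_pos sg_delta) flow = flow.
  by elim: m => //= m ->; exact: sliding_flow.
by move=> /(congr1 (fun a : shift_group => a.1 0%R)); rewrite !ffunE.
Qed.

Lemma degree_dp p : degree (expgz sg_delta p) = (7 * p)%R.
Proof.
have deg_delta : degree sg_delta = 7%R.
  rewrite /degree /= (eq_bigr (fun=> 2%R)) => [|i _]; last by rewrite ffunE.
  by rewrite sumr_const card_ord.
have degX (n : nat) : degree (sg_delta ^+ n) = (7 * n%:Z)%R.
  elim: n => [|n IHn]; first by rewrite degree1.
  by rewrite expgSr degreeM IHn deg_delta; lia.
by case: p => n; rewrite /expgz ?degreeV degX //; lia.
Qed.

(** A conjugate of length [0] would be a power of [Δ]; the degree of [jam] is [4]
    and that of [Δ] is [7]. *)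
Lemma slen_jam : slen sg_pos sg_delta jam = 1%R.
Proof.
have [[z [a _ za] zl] lb] := slenP sg_garside sg_delta_neq1 jam.
have := lb jam (conj_class_refl jam); have := glen_ge0 sg_garside sg_delta_neq1 z.
rewrite zl /glen; have [-> ->] := jam_levels => ge0 le1.
suff : slen sg_pos sg_delta jam <> 0%R by lia.
move=> sl0; rewrite /glen sl0 in zl.
have [low up] := interval_inf_sup sg_garside sg_delta_neq1 z.
have zE : z = expgz sg_delta (ginf sg_pos sg_delta z).
  apply: (gle_anti sg_garside) => //.
  by rewrite (_ : ginf _ _ z = gsup sg_pos sg_delta z) //; lia.
have deg_jam : degree jam = 4%R.
  by rewrite /degree /= (big_ord_recl 2) (big_ord_recl 1) big_ord_recl big_ord0 !ffunE.
have : degree jam = degree z by rewrite -za degreeJ.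
by rewrite zE degree_dp deg_jam; lia.
Qed.

End ShiftGroup.

(** * The chain of inclusions *)

Lemma trivial_of_delta1 (G : groupType) (P : set G) (D : G) :
  garside_structure P D -> D = 1%g -> forall a : G, a = 1%g.
Proof.
move=> gs D1 a; have := simples_generate gs; rewrite D1 => gen.
suff : smallest (fun H : set G => monoid.group_closed [in H]) (simples P 1%g) `<=` [set 1%g].
  by rewrite gen; apply.
apply: smallest_sub => [|b [b1 b1']]; last exact/esym/(gle_anti gs).
split=> [|b c]; first exact/mem_set.
by move=> /set_mem /= -> /set_mem /= ->; apply/mem_set; rewrite /= mulgV.
Qed.

Theorem proposition3p13 :
  (forall (G : groupType) (P : set G) (D : G),
     garside_structure P D -> finite_type P D ->
     forall x : G,
       [/\ SC P D x `<=` RSSS P D x,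
           RSSS P D x `<=` USS P D x,
           USS P D x `<=` SSS P D x
         & SSS P D x `<=` SS P D x]
       /\ ((1 < slen P D x)%R -> SC P D x = RSSS P D x)
       /\ (slen P D x = 1%R ->
             [/\ SC P D x `<=` RSSS P D x,
                 RSSS P D x = USS P D x
               & USS P D x = SSS P D x]))
  /\ (exists (G : groupType) (P : set G) (D : G),
        [/\ garside_structure P D, finite_type P D
          & exists x : G, slen P D x = 1%R /\ SC P D x `<` RSSS P D x]).
Proof.
split=> [G P D gs fin x|]; last first.
  exists shift_group, sg_pos, sg_delta; split; [exact: sg_garside | exact: sg_finite_type |].
  exists jam; split; first exact: slen_jam.
  split; first exact: (SC_sub_RSSS sg_garside sg_finite_type sg_delta_neq1).
  move=> RSSS_sub_SC; apply/jam_not_SC/RSSS_sub_SC.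
  apply: (SSS_sub_RSSS sg_garside sg_finite_type sg_delta_neq1 slen_jam).
  split=> [|z xz]; first exact: conj_class_refl.
  rewrite {1}/glen; have [-> ->] := jam_levels; rewrite subr0 -slen_jam.
  exact: (slenP sg_garside sg_delta_neq1 jam).2.
(* If D = 1 then G is trivial and every set in the statement is {x}. *)
have [D1|D_neq1] := eqVneq D 1%g.
  have eqG (y z : G) : y = z.
    by rewrite (trivial_of_delta1 gs D1 y) (trivial_of_delta1 gs D1 z).
  have allE (A B : set G) : B x -> A `<=` B by move=> Bx y _; rewrite (eqG y x).
  have periodicE (f : G -> G) y : periodic f y by exists 1%N => //; exact: eqG.
  have xx := conj_class_refl x.
  have SCx : SC P D x x by split.
  have RSSSx : RSSS P D x x by split.
  have SSSx : SSS P D x x by split=> // z _; rewrite (eqG z x).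
  have USSx : USS P D x x by split.
  have SSx : SS P D x x by split=> // z _; rewrite (eqG z x).
  have eqE (A B : set G) : A x -> B x -> A = B.
    by move=> Ax Bx; apply/seteqP; split; exact: allE.
  split; first by split; exact: allE.
  by split=> _; [exact: eqE | split; [exact: allE | exact: eqE | exact: eqE]].
move/eqP: D_neq1 => D_neq1.
have SCR := SC_sub_RSSS gs fin D_neq1 (x := x).
have RU := RSSS_sub_USS gs fin D_neq1 (x := x).
have US : USS P D x `<=` SSS P D x by move=> y [].
split; first by split=> //; exact: SSS_sub_SS.
split=> [long|sl1]; first exact: SC_eq_RSSS.
have SR := SSS_sub_RSSS gs fin D_neq1 sl1.
split=> //; apply/seteqP; split=> //; last by move=> y /SR/RU.
by move=> y /US/SR.
Qed.
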